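(* An integral domain $R$ is a dp-minimal Noetherian domain if and only if it is one of the following: (1) a dp-minimal field; (2) an equicharacteristic dp-minimal DVR; (3) a finite-index subring of a mixed characteristic dp-minimal DVR.
   Context: Rings are commutative and unital; a ring is dp-minimal if the structure $(R,+,\cdot)$ in the language of rings has dp-rank $1$. A DVR is a discrete valuation ring. A dp-minimal DVR has fraction field of characteristic $0$, and its residue field is either a (dp-minimal) field of characteristic $0$ or a finite field; an equicharacteristic dp-minimal DVR is a dp-minimal DVR whose residue field has characteristic $0$, and a mixed characteristic dp-minimal DVR is a dp-minimal DVR whose residue field is finite. A finite-index subring of a ring $A$ is a subring $S\subseteq A$ such that $S$ has finite index in the additive group $(A,+)$. *)

(* Defs.v *)
From mathcomp Require Import all_boot all_algebra.
Set Implicit Arguments.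
Unset Strict Implicit.
Unset Printing Implicit Defensive.
Import GRing.Theory.
Local Open Scope ring_scope.

(* First-order formulas of the language of rings are represented by
   GRing.formula R (terms may contain constants from R = parameters, and the
   symbols Inv / Unit, which are definable in the ring language, so the
   structure is a definitional expansion of (R,+,.) with the same dp-rank).
   In a formula phi, the variable 'X_0 plays the role of the object variable x
   (a single variable) and 'X_1, 'X_2, ... are parameter variables; the
   environment (a :: b) assigns a to x and the list b to the parameters. *)

Definition ict2_pattern (R : unitRingType) (phi psi : GRing.formula R) (N : nat) :=
  exists (b c : nat -> seq R),
    forall i j, (i < N)%N -> (j < N)%N ->
      exists a : R, forall i' j', (i' < N)%N -> (j' < N)%N ->
        (GRing.holds (a :: b i') phi <-> i' = i) /\
        (GRing.holds (a :: c j') psi <-> j' = j).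

Definition infinite_type (T : eqType) := ~ exists s : seq T, forall x : T, x \in s.

(* dp-rank of (R,+,.) equals 1: R is infinite (dp-rank >= 1) and there is no
   ICT pattern of depth 2 in any elementary extension; by compactness the latter
   is equivalent to: for all phi, psi, the finite patterns have bounded size. *)
Definition dp_minimal (R : unitRingType) :=
  infinite_type R /\
  forall phi psi : GRing.formula R, exists N : nat, ~ ict2_pattern phi psi N.

Definition is_ideal (R : comNzRingType) (I : R -> Prop) :=
  I 0 /\ (forall x y, I x -> I y -> I (x + y)) /\ (forall r x, I x -> I (r * x)).

Definition noetherian (R : comNzRingType) :=
  forall I : nat -> R -> Prop,
    (forall n, is_ideal (I n)) ->
    (forall n x, I n x -> I n.+1 x) ->
    exists n0, forall n x, (n0 <= n)%N -> I n x -> I n0 x.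

Definition is_field (R : comUnitRingType) := forall x : R, x != 0 -> x \is a GRing.unit.

Definition principal_ideal_ring (R : comNzRingType) :=
  forall I : R -> Prop, is_ideal I -> exists g : R, forall x, I x <-> exists r, x = r * g.

Definition local_ring (R : comUnitRingType) :=
  is_ideal (fun x : R => x \isn't a GRing.unit).

Definition DVR (R : idomainType) :=
  principal_ideal_ring R /\ local_ring R /\ ~ is_field R.

Definition residue_char0 (R : comUnitRingType) :=
  forall n : nat, (0 < n)%N -> (n%:R : R) \is a GRing.unit.

Definition residue_finite (R : comUnitRingType) :=
  exists s : seq R, forall x : R, exists2 y, y \in s & (x - y) \isn't a GRing.unit.

Definition equichar_dpmin_DVR (R : idomainType) :=
  DVR R /\ dp_minimal R /\ residue_char0 R.

Definition mixedchar_dpmin_DVR (R : idomainType) :=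
  DVR R /\ dp_minimal R /\ residue_finite R.

Definition finite_index_subring_via (S A : idomainType) (f : {rmorphism S -> A}) :=
  injective f /\
  exists s : seq A, forall a : A, exists2 t, t \in s & exists x : S, a - t = f x.

(* Main.v *)
(* Let R be a dp-minimal Noetherian domain which is not a field. It is local: if
   a + b = 1 with a, b nonunits, the elements a^i b^j give an ICT pattern of depth
   2. As aR and bR cannot both have large index over their intersection, there is N
   such that for all a, b one of the ideals (aR : b), (bR : a) has index < N, hence
   is R if the residue field is infinite, and contains the N-th power of the maximal
   ideal m in any case.

   If the residue field is infinite, R is thus a Noetherian valuation ring, and a
   Frobenius argument excludes residue characteristic p > 0. If it is finite, some
   f in m divides a power of m, so that R/fR is finite, and e = f^(N+1) satisfies
   ex in R or e/x in R for each x in the fraction field. It follows that the ring A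
   of almost integral elements (those x such that d x^n is in R for all n and some
   d != 0) is a valuation ring contained in e^-3 R. So R has finite index in A, A
   is a DVR, and A is definable in R through x |-> e^3 x, hence dp-minimal.

   Conversely, a finite-index subring of a DVR A with finite residue field contains
   a nonzero ideal gA of A, hence is a finite union of cosets of gA, thus definable
   in A. *)
Require Import Defs.
From HB Require Import structures.
From mathcomp Require Import all_boot all_algebra boolp ring.
Set Implicit Arguments.
Unset Strict Implicit.
Unset Printing Implicit Defensive.
Import GRing.Theory.
Local Open Scope ring_scope.

Local Notation "x %:F" := (@FracField.tofrac _ x) (format "x %:F").

(** * The ring of almost integral elements *)

Section AlmostIntegral.
Variable R : idomainType.

Definition tofrac_image (x : {fraction R}) := exists r : R, x = r%:F.

(** The complete integral closure of R, made a boolean predicate so that the subtype [cic] can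
    inherit its ring structure. *)
Definition almost_integral : pred {fraction R} :=
  fun x => `[< exists2 d : R, d != 0 & forall n, tofrac_image (d%:F * x ^+ n) >].

Lemma almost_integralP x :
  reflect (exists2 d : R, d != 0 & forall n, tofrac_image (d%:F * x ^+ n))
          (x \in almost_integral).
Proof. exact: asboolP. Qed.

Lemma tofrac_imageD x y :
  tofrac_image x -> tofrac_image y -> tofrac_image (x + y).
Proof. by move=> [r ->] [s ->]; exists (r + s); rewrite rmorphD. Qed.

Lemma tofrac_imageM x y :
  tofrac_image x -> tofrac_image y -> tofrac_image (x * y).
Proof. by move=> [r ->] [s ->]; exists (r * s); rewrite rmorphM. Qed.

Lemma tofrac_imageMn x n : tofrac_image x -> tofrac_image (x *+ n).
Proof. by move=> [r ->]; exists (r *+ n); rewrite rmorphMn. Qed.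

Lemma tofrac_image_sum (I : finType) (F : I -> {fraction R}) :
  (forall i, tofrac_image (F i)) -> tofrac_image (\sum_i F i).
Proof.
move=> FP; elim/big_rec: _ => [|i x _ xP]; first by exists 0; rewrite rmorph0.
exact: tofrac_imageD.
Qed.

Lemma almost_integral_tofrac r : r%:F \in almost_integral.
Proof.
apply/almost_integralP; exists 1; first exact: oner_neq0.
by move=> n; exists (r ^+ n); rewrite rmorph1 mul1r rmorphXn.
Qed.

(** The product of two denominators serves for products and for sums: each term of (x + y)^n times d
    d' is an integer multiple of d x^k times d' y^l. *)
Lemma almost_integral_subring : subring_closed almost_integral.
Proof.
have aiM : {in almost_integral &, forall x y, x * y \in almost_integral}.
  move=> x y /almost_integralP[d d0 dP] /almost_integralP[d' d'0 d'P].
  apply/almost_integralP; exists (d * d'); first exact: mulf_neq0.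
  by move=> n; rewrite rmorphM exprMn mulrACA; apply: tofrac_imageM.
have ai1 : 1 \in almost_integral.
  by rewrite -(rmorph1 (@FracField.tofrac R)) almost_integral_tofrac.
split=> // x y xA yA; have : - 1%:F * y \in almost_integral.
  by apply: aiM => //; rewrite -rmorphN almost_integral_tofrac.
rewrite rmorph1 mulN1r => {yA}; move: (- y) => {}y yA.
move: xA yA => /almost_integralP[d d0 dP] /almost_integralP[d' d'0 d'P].
apply/almost_integralP; exists (d * d'); first exact: mulf_neq0.
move=> n; rewrite rmorphM exprDn mulr_sumr; apply: tofrac_image_sum => i.
by rewrite -mulrnAr mulrACA; apply: tofrac_imageM; rewrite ?mulrnAr //; apply: tofrac_imageMn.
Qed.

HB.instance Definition _ :=
  GRing.isSubringClosed.Build {fraction R} almost_integral almost_integral_subring.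

Record cic := Cic { cic_val : {fraction R}; _ : cic_val \in almost_integral }.

HB.instance Definition _ := [isSub for cic_val].
HB.instance Definition _ := [Choice of cic by <:].
HB.instance Definition _ := [SubChoice_isSubComNzRing of cic by <:].

Definition cic_unit : pred cic :=
  fun x => (val x != 0) && ((val x)^-1 \in almost_integral).

Definition cic_inv (x : cic) : cic := if cic_unit x then insubd x (val x)^-1 else x.

Lemma cic_mulVr : {in cic_unit, left_inverse 1 cic_inv *%R}.
Proof.
move=> x xU; apply: val_inj; rewrite rmorphM rmorph1 /cic_inv ifT //.
by case/andP: xU => x0 xA; rewrite /= insubdK // mulVf.
Qed.

Lemma cic_unitPl x y : y * x = 1 -> cic_unit x.
Proof.
move/(congr1 val); rewrite rmorphM rmorph1 => yx1.
have x0 : val x != 0.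
  by apply/eqP => x0; move/esym/eqP: yx1; rewrite /= x0 mulr0 oner_eq0.
by rewrite /cic_unit x0 -[_^-1]mul1r -yx1 mulfK //; apply: valP.
Qed.

Lemma cic_inv_out : {in [predC cic_unit], cic_inv =1 id}.
Proof. by move=> x xU; rewrite /cic_inv ifN. Qed.

HB.instance Definition _ :=
  GRing.ComNzRing_hasMulInverse.Build cic cic_mulVr cic_unitPl cic_inv_out.
HB.instance Definition _ := [SubComUnitRing_isSubIntegralDomain of cic by <:].

Lemma cic_unitE (x : cic) :
  (x \is a GRing.unit) = (val x != 0) && ((val x)^-1 \in almost_integral).
Proof. by []. Qed.

Definition to_cic (r : R) : cic := Cic (almost_integral_tofrac r).

Lemma to_cic_zmod_morphism : zmod_morphism to_cic.
Proof. by move=> x y; apply: val_inj; rewrite /= !rmorphB. Qed.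

Lemma to_cic_monoid_morphism : monoid_morphism to_cic.
Proof.
by split=> [|x y]; apply: val_inj; rewrite /= ?rmorph1 // !rmorphM.
Qed.

HB.instance Definition _ := GRing.isZmodMorphism.Build R cic to_cic to_cic_zmod_morphism.
HB.instance Definition _ := GRing.isMonoidMorphism.Build R cic to_cic to_cic_monoid_morphism.

Lemma to_cic_inj : injective to_cic.
Proof. by move=> x y /(congr1 val)/eqP /=; rewrite tofrac_eq => /eqP. Qed.

End AlmostIntegral.

(** * Interpretations *)

(* If [h] identifies B with [h(B)] carrying the product x y / h(1), and h(B) is
   a finite union of cosets of a principal ideal of C, then B is definable in C. *)
Section Transfer.
Variables (B C : idomainType) (h : {additive B -> C}).
Hypothesis h_inj : injective h.
Hypothesis hM : forall x y, h x * h y = h 1 * h (x * y).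
Variables (g : C) (t : seq C).
Hypothesis h_im :
  forall y, (exists x, y = h x) <-> exists2 c, c \in t & exists z, y = c + g * z.

(* The second component [n] records that the first one denotes h(1)^(n - 1)
   times the image of the value of [u]. *)
Fixpoint transfer_term (u : GRing.term B) : GRing.term C * nat :=
  match u with
  | GRing.Var i => (GRing.Var C i, 1%N)
  | GRing.Const c => (GRing.Const (h c), 1%N)
  | GRing.NatConst n => (GRing.NatConst C n, 0%N)
  | GRing.Add u1 u2 =>
      let: (v1, n1) := transfer_term u1 in
      let: (v2, n2) := transfer_term u2 in
      (GRing.Add (GRing.Mul v1 (GRing.Const (h 1 ^+ n2)))
                 (GRing.Mul v2 (GRing.Const (h 1 ^+ n1))), (n1 + n2)%N)
  | GRing.Opp u1 =>
      let: (v1, n1) := transfer_term u1 in (GRing.Opp v1, n1)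
  | GRing.NatMul u1 k =>
      let: (v1, n1) := transfer_term u1 in (GRing.NatMul v1 k, n1)
  | GRing.Mul u1 u2 =>
      let: (v1, n1) := transfer_term u1 in
      let: (v2, n2) := transfer_term u2 in (GRing.Mul v1 v2, (n1 + n2)%N)
  | GRing.Inv u1 => transfer_term u1
  | GRing.Exp u1 k =>
      let: (v1, n1) := transfer_term u1 in (GRing.Exp v1 k, (n1 * k)%N)
  end.

(** Only variable i is free here, so binding i + 1 captures nothing. *)
Definition image_formula i : GRing.formula C :=
  foldr (fun c f => GRing.Or (GRing.Exists i.+1 (GRing.Equal (GRing.Var C i)
    (GRing.Add (GRing.Const c) (GRing.Mul (GRing.Const g) (GRing.Var C i.+1))))) f)
    (GRing.Bool false) t.

(** Powers of h(1) bring both sides of an equation to the same scale. The value at [Unit], like that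
    of [transfer_term] at [Inv], is a default: [GRing.to_rform] eliminates both symbols
    beforehand. *)
Fixpoint transfer_formula (f : GRing.formula B) : GRing.formula C :=
  match f with
  | GRing.Bool b => GRing.Bool b
  | GRing.Equal u1 u2 =>
      let: (v1, n1) := transfer_term u1 in
      let: (v2, n2) := transfer_term u2 in
      GRing.Equal (GRing.Mul v1 (GRing.Const (h 1 ^+ n2)))
                  (GRing.Mul v2 (GRing.Const (h 1 ^+ n1)))
  | GRing.Unit _ => GRing.Bool false
  | GRing.And f1 f2 => GRing.And (transfer_formula f1) (transfer_formula f2)
  | GRing.Or f1 f2 => GRing.Or (transfer_formula f1) (transfer_formula f2)
  | GRing.Implies f1 f2 => GRing.Implies (transfer_formula f1) (transfer_formula f2)
  | GRing.Not f1 => GRing.Not (transfer_formula f1)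
  | GRing.Exists i f1 =>
      GRing.Exists i (GRing.And (image_formula i) (transfer_formula f1))
  | GRing.Forall i f1 =>
      GRing.Forall i (GRing.Implies (image_formula i) (transfer_formula f1))
  end.

Lemma transfer_unit_neq0 : h 1 != 0.
Proof. by rewrite -(raddf0 h) (inj_eq h_inj) oner_neq0. Qed.

(** The factor h(1) on the left avoids the exponent n - 1, which would be negative for natural
    constants, where n = 0. *)
Lemma eval_transfer_term e u : GRing.rterm u ->
  GRing.eval (map h e) (transfer_term u).1 * h 1
  = h 1 ^+ (transfer_term u).2 * h (GRing.eval e u).
Proof.
have d0 := transfer_unit_neq0.
elim: u => //=.
- move=> i _; rewrite expr1 mulrC; congr (_ * _).
  have [lt_ie|le_ei] := ltnP i (size e); first by rewrite (nth_map 0).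
  by rewrite !nth_default ?size_map // raddf0.
- by move=> c _; rewrite expr1 mulrC.
- by move=> n _; rewrite expr0 mul1r raddfMn /= mulr_natl.
- move=> u1 IH1 u2 IH2 /andP[/IH1 {}IH1 /IH2 {}IH2].
  case: (transfer_term u1) (transfer_term u2) IH1 IH2 => [v1 n1] [v2 n2] /= E1 E2.
  by rewrite raddfD /= mulrDr mulrDl mulrAC E1 [X in _ + X]mulrAC E2 exprD; ring.
- move=> u1 IH1 /IH1; case: (transfer_term u1) => [v1 n1] /= E1.
  by rewrite mulNr E1 raddfN mulrN.
- move=> u1 IH1 k /IH1; case: (transfer_term u1) => [v1 n1] /= E1.
  by rewrite mulrnAl E1 raddfMn mulrnAr.
- move=> u1 IH1 u2 IH2 /andP[/IH1 {}IH1 /IH2 {}IH2].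
  case: (transfer_term u1) (transfer_term u2) IH1 IH2 => [v1 n1] [v2 n2] /= E1 E2.
  apply: (mulIf d0).
  transitivity (h 1 ^+ n1 * h 1 ^+ n2 * (h (GRing.eval e u1) * h (GRing.eval e u2))).
    by rewrite mulrACA -E1 -E2; ring.
  by rewrite hM exprD; ring.
- move=> u1 IH1 k /IH1; case: (transfer_term u1) => [v1 n1] /= E1.
  elim: k => [|k IHk]; first by rewrite muln0 !expr0.
  set x := GRing.eval e u1 in E1 IHk *.
  apply: (mulIf d0); transitivity (h 1 ^+ n1 * h 1 ^+ (n1 * k) * (h x * h (x ^+ k))).
    by rewrite mulrACA -E1 -IHk exprS; ring.
  by rewrite hM -exprS mulnS exprD; ring.
Qed.

Lemma image_formulaP e i :
  GRing.holds e (image_formula i) <-> exists x, e`_i = h x.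
Proof.
have neq_iS : (i == i.+1) = false by rewrite ltn_eqF.
rewrite h_im /image_formula; elim: t => [|c s IHs] /=; first by split=> // -[].
rewrite IHs; split.
  case=> [[z]|[c' c's yP]]; last by exists c' => //; rewrite inE c's orbT.
  rewrite !nth_set_nth /= eqxx neq_iS => yE; exists c; first exact: mem_head.
  by exists z.
case=> c'; rewrite inE => /orP[/eqP->|c's] [z yE]; last by right; exists c' => //; exists z.
by left; exists z; rewrite !nth_set_nth /= eqxx neq_iS.
Qed.

Lemma same_env_map_set_nth e i x :
  GRing.same_env (set_nth 0 (map h e) i (h x)) (map h (set_nth 0 e i x)).
Proof.
have nth_h s j : (map h s)`_j = h s`_j.
  have [lt_js|le_sj] := ltnP j (size s); first by rewrite (nth_map 0).
  by rewrite !nth_default ?size_map // raddf0.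
by move=> j; rewrite nth_h !nth_set_nth /= nth_h; case: ifP.
Qed.

Lemma holds_transfer e f : GRing.rformula f ->
  GRing.holds (map h e) (transfer_formula f) <-> GRing.holds e f.
Proof.
have d0 := transfer_unit_neq0.
elim: f e => //=.
- move=> u1 u2 e /andP[/(eval_transfer_term e) + /(eval_transfer_term e)].
  case: (transfer_term u1) (transfer_term u2) => [v1 n1] [v2 n2] /= E1 E2.
  split=> [E|E].
    apply: h_inj; apply: (mulfI (expf_neq0 (n1 + n2) d0)).
    transitivity (GRing.eval (map h e) v1 * h 1 ^+ n2 * h 1).
      by rewrite mulrAC E1 exprD; ring.
    by rewrite E mulrAC E2 exprD; ring.
  apply: (mulIf d0); rewrite mulrAC E1 [RHS]mulrAC E2 E; ring.
- by move=> f1 IH1 f2 IH2 e /andP[/(IH1 e) -> /(IH2 e) ->].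
- by move=> f1 IH1 f2 IH2 e /andP[/(IH1 e) -> /(IH2 e) ->].
- by move=> f1 IH1 f2 IH2 e /andP[/(IH1 e) H1 /(IH2 e) H2]; tauto.
- by move=> f1 IH1 e /(IH1 e) H1; tauto.
- move=> i f1 IH1 e rf1; split.
    case=> y [/image_formulaP [x]]; rewrite nth_set_nth /= eqxx => -> yP.
    by exists x; apply/IH1 => //; apply: GRing.eq_holds yP; apply: same_env_map_set_nth.
  case=> x xP; exists (h x); split.
    by apply/image_formulaP; exists x; rewrite nth_set_nth /= eqxx.
  apply: GRing.eq_holds (GRing.same_env_sym (same_env_map_set_nth _ _ _)) _.
  exact/IH1.
- move=> i f1 IH1 e rf1; split.
    move=> yP x; apply/IH1 => //; apply: GRing.eq_holds (same_env_map_set_nth _ _ _) _.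
    by apply: yP; apply/image_formulaP; exists x; rewrite nth_set_nth /= eqxx.
  move=> xP y /image_formulaP [x]; rewrite nth_set_nth /= eqxx => ->.
  apply: GRing.eq_holds (GRing.same_env_sym (same_env_map_set_nth _ _ _)) _.
  exact/IH1.
Qed.

Lemma dp_minimal_transfer : infinite_type B -> dp_minimal C -> dp_minimal B.
Proof.
move=> Binf [_ Cmin]; split=> // phi psi.
pose tr f := transfer_formula (GRing.to_rform f).
have trP e f : GRing.holds (map h e) (tr f) <-> GRing.holds e f.
  by rewrite /tr holds_transfer ?GRing.to_rformP ?GRing.to_rform_rformula.
have [N noN] := Cmin (tr phi) (tr psi); exists N => -[b [c bcP]]; apply: noN.
exists (map h \o b), (map h \o c) => i j ltiN ltjN.
have [a aP] := bcP i j ltiN ltjN; exists (h a) => i' j' lti'N ltj'N.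
by rewrite -!map_cons /= -!map_cons !trP; apply: aP.
Qed.

End Transfer.

(** * Ideals of finite index *)

Section Separated.
Variables (T : eqType) (E : T -> T -> Prop).

Lemma separated_sequence :
  (forall s : seq T, exists x, forall y, y \in s -> ~ E x y) ->
  exists r : nat -> T, forall i j, (i < j)%N -> ~ E (r j) (r i).
Proof.
move/choice=> [next nextP].
(* [l n] lists the first n terms; the next term is chosen to avoid them all. *)
pose l := fix l n := if n is m.+1 then next (l m) :: l m else [::].
exists (fun n => next (l n)) => i j ltij; apply: nextP.
elim: j ltij => //= j IHj; rewrite ltnS leq_eqVlt inE => /orP[/eqP->|/IHj->].
  by rewrite eqxx.
by rewrite orbT.
Qed.

End Separated.

Lemma infinite_typeP (T : eqType) :
  infinite_type T -> exists r : nat -> T, injective r.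
Proof.
move=> Tinf; have [|r rP] := @separated_sequence T (fun x y => x = y).
  move=> s; apply: contrapT => /forallNP sP; apply: Tinf; exists s => x.
  by have /existsNP[y /not_implyP[ys /contrapT->]] := sP x.
exists r => i j rij; by case: (ltngtP i j) => // /rP; rewrite rij => nE; case: nE.
Qed.

Lemma infinite_type_pigeonhole (T U : eqType) (E : T -> U -> Prop) (s : seq U) :
  infinite_type T -> (forall x, exists2 y, y \in s & E x y) ->
  exists x x' y, [/\ x != x', E x y & E x' y].
Proof.
move=> /infinite_typeP[r r_inj] sP.
have /choice[phi phiP] : forall x, exists y, y \in s /\ E x y.
  by move=> x; have [y ys xy] := sP x; exists y.
apply: contrapT => noc; pose v := [seq phi (r i) | i <- iota 0 (size s).+1].
have v_uniq : uniq v.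
  rewrite map_inj_uniq ?iota_uniq // => i j eq_ij; apply: contrapT => neq_ij; apply: noc.
  exists (r i), (r j), (phi (r i)); split; [|exact: (phiP _).2|].
    by apply/eqP => /r_inj.
  by rewrite eq_ij; apply: (phiP _).2.
have /(uniq_leq_size v_uniq) : {subset v <= s}.
  by move=> _ /mapP[i _ ->]; apply: (phiP _).1.
by rewrite size_map size_iota ltnn.
Qed.

Section Ideals.
Variable R : comNzRingType.
Implicit Types I J : R -> Prop.

Definition multiples (a : R) : R -> Prop := fun x => exists r, x = a * r.

Definition finite_quotient I :=
  exists s : seq R, forall x, exists2 y, y \in s & I (x - y).

Lemma ideal_zero I : is_ideal I -> I 0. Proof. by case. Qed.
Lemma ideal_add I x y : is_ideal I -> I x -> I y -> I (x + y).
Proof. by move=> [_ [h _]]; apply: h. Qed.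
Lemma ideal_mull I r x : is_ideal I -> I x -> I (r * x).
Proof. by move=> [_ [_ h]]; apply: h. Qed.
Lemma ideal_mulr I r x : is_ideal I -> I x -> I (x * r).
Proof. by rewrite mulrC; apply: ideal_mull. Qed.
Lemma ideal_opp I x : is_ideal I -> I x -> I (- x).
Proof. by rewrite -mulN1r; apply: ideal_mull. Qed.
Lemma ideal_sub I x y : is_ideal I -> I x -> I y -> I (x - y).
Proof. by move=> Iid Ix Iy; apply: ideal_add => //; apply: ideal_opp. Qed.

Lemma multiples_ideal a : is_ideal (multiples a).
Proof.
split; first by exists 0; rewrite mulr0.
split=> [_ _ [x ->] [y ->]|r _ [x ->]]; first by exists (x + y); rewrite mulrDr.
by exists (r * x); rewrite mulrCA.
Qed.

Lemma multiples_self a : multiples a a.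
Proof. by exists 1; rewrite mulr1. Qed.

Lemma multiples_min I a : is_ideal I -> I a -> forall x, multiples a x -> I x.
Proof. by move=> Iid Ia _ [r ->]; apply: ideal_mulr. Qed.

Lemma finite_quotient_sub I J :
  (forall x, I x -> J x) -> finite_quotient I -> finite_quotient J.
Proof.
by move=> sIJ [s sP]; exists s => x; have [y ys /sIJ] := sP x; exists y.
Qed.

Lemma finite_quotientM a b :
  finite_quotient (multiples a) -> finite_quotient (multiples b) ->
  finite_quotient (multiples (a * b)).
Proof.
move=> [s sP] [t tP]; exists [seq y + a * z | y <- s, z <- t] => x.
have [y ys [r xE]] := sP x; have [z zt [w rE]] := tP r.
exists (y + a * z); first by apply/allpairsP; exists (y, z).
by exists w; rewrite opprD addrA xE -mulrBr rE mulrA.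
Qed.

Lemma finite_quotient1 : finite_quotient (multiples 1).
Proof.
by exists [:: 0] => x; exists 0; rewrite ?mem_head //; exists x; rewrite subr0 mul1r.
Qed.

Lemma finite_quotientX a n :
  finite_quotient (multiples a) -> finite_quotient (multiples (a ^+ n)).
Proof.
move=> afin; elim: n => [|n IHn]; first exact: finite_quotient1.
by rewrite exprS; apply: finite_quotientM.
Qed.

Lemma infinite_quotient_sequence I : is_ideal I -> ~ finite_quotient I ->
  exists r : nat -> R, forall i j, i != j -> ~ I (r i - r j).
Proof.
move=> Iid Iinf; have [|r rP] := @separated_sequence R (fun x y => I (x - y)).
  move=> s; apply: contrapT => /forallNP sP; apply: Iinf; exists s => x.
  by have /existsNP[y /not_implyP[ys /contrapT]] := sP x; exists y.
exists r => i j; case: ltngtP => // lt_ij _; last exact: rP.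
by rewrite -opprB => /(ideal_opp Iid); rewrite opprK; apply: rP.
Qed.

(** A coset of gR that meets I lies in I, so the representatives lying in I are enough. *)
Lemma union_of_cosets I g :
  (forall x y, I x -> I y -> I (x + y)) -> (forall x, I x -> I (- x)) ->
  (forall z, I (g * z)) -> finite_quotient (multiples g) ->
  exists t : seq R, forall y, I y <-> exists2 c, c \in t & exists z, y = c + g * z.
Proof.
move=> ID IN Ig [s sP]; exists [seq c <- s | `[< I c >]] => y; split=> [Iy|].
  have [c cs [z yE]] := sP y; exists c; last by exists z; rewrite -yE addrC subrK.
  rewrite mem_filter cs andbT; apply/asboolP.
  have -> : c = y - g * z by rewrite -yE opprB addrC subrK.
  by apply: ID => //; apply: IN.
by case=> c; rewrite mem_filter => /andP[/asboolP Ic _] [z ->]; apply: ID.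
Qed.

(** Otherwise choice gives a strictly larger member for each member of F, and iteration from [I0]
    contradicts the ascending chain condition. *)
Lemma noetherian_maximal (F : (R -> Prop) -> Prop) I0 :
  noetherian R -> (forall I, F I -> is_ideal I) -> F I0 ->
  exists2 I, F I & forall J, F J -> (forall x, I x -> J x) -> forall x, J x -> I x.
Proof.
move=> Rnoeth Fid FI0; apply: contrapT => nomax.
have /choice[next nextP] : forall I : {I | F I}, exists J : {J | F J},
    (forall x, sval I x -> sval J x) /\ exists x, sval J x /\ ~ sval I x.
  move=> [I FI]; apply: contrapT => noJ; apply: nomax; exists I => // J FJ sIJ x Jx.
  by apply: contrapT => nIx; apply: noJ; exists (exist F J FJ); split=> //; exists x.
pose I n := sval (iter n next (exist F I0 FI0)).
have [||n0 /(_ n0.+1)n0P] := Rnoeth I.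
- by move=> n; apply: Fid; apply: svalP.
- by move=> n x; apply: (nextP _).1.
have [x [Jx []]] := (nextP (iter n0 next (exist F I0 FI0))).2.
exact: n0P.
Qed.

Lemma principal_noetherian : principal_ideal_ring R -> noetherian R.
Proof.
move=> Rpid I Iid Isub.
have leI m n x : (m <= n)%N -> I m x -> I n x.
  by move=> /subnK<-; elim: (n - m)%N => // k IHk /IHk/Isub.
have [|g gP] := Rpid (fun x => exists n, I n x).
  split; first by exists 0%N; apply: ideal_zero.
  split=> [x y [m Imx] [n Iny]|r x [n Inx]]; last by exists n; apply: ideal_mull.
  exists (maxn m n); apply: ideal_add => //.
    by apply: leI Imx; apply: leq_maxl.
  by apply: leI Iny; apply: leq_maxr.
have [n0 In0g] : exists n, I n g by apply/gP; exists 1; rewrite mul1r.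
exists n0 => n x _ Inx; have [r ->] : exists r, x = r * g by apply/gP; exists n.
exact: ideal_mull.
Qed.

End Ideals.

Lemma field_noetherian (R : comUnitRingType) : is_field R -> noetherian R.
Proof.
move=> Rfield; apply: principal_noetherian => I Iid.
have [[x [Ix /Rfield x0]]|I0] := pselect (exists x, I x /\ x != 0).
  exists x => y; split=> [_|[r ->]]; last exact: ideal_mull.
  by exists (y / x); rewrite divrK.
exists 0 => y; split=> [Iy|[r ->]]; last by rewrite mulr0; apply: ideal_zero.
exists 0; rewrite mulr0; apply: contrapT => /eqP y0; apply: I0; by exists y.
Qed.

Lemma DVR_uniformizer (A : idomainType) : DVR A ->
  exists2 p : A, p != 0 & forall x, x \isn't a GRing.unit <-> multiples p x.
Proof.
move=> [Apid [Aloc nAfield]]; have [p pP] := Apid _ Aloc.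
have pP' x : x \isn't a GRing.unit <-> multiples p x.
  by rewrite pP; split=> -[r ->]; exists r; rewrite mulrC.
exists p => //; apply/eqP => p0; apply: nAfield => x x0; apply: contraT => /pP'[r].
by move/eqP; rewrite p0 mul0r (negPf x0).
Qed.

(** Noetherian induction: take yA maximal among the nonzero principal ideals of infinite index. Then
    y = pz with p a uniformizer; zA is strictly larger, so it has finite index, and so has pzA. *)
Lemma DVR_finite_quotient (A : idomainType) (x : A) :
  DVR A -> residue_finite A -> x != 0 -> finite_quotient (multiples x).
Proof.
move=> Advr Afin x0; apply: contrapT => xinf.
have [p p0 pP] := DVR_uniformizer Advr.
pose F I := exists y : A, [/\ y != 0, ~ finite_quotient (multiples y) & I = multiples y].
have [|I [y [_ _ ->]]||_ [y [y0 yinf ->]] ymax] := @noetherian_maximal A F (multiples x).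
- by apply: principal_noetherian; case: Advr.
- exact: multiples_ideal.
- by exists x.
have p_nunit : p \isn't a GRing.unit by apply/pP; apply: multiples_self.
have [/pP[z yE]|yU] := boolP (y \isn't a GRing.unit); last first.
  apply: yinf; apply: finite_quotient_sub (finite_quotient1 A) => z _.
  by exists (y^-1 * z); rewrite mulVKr // -[_ \is a _]negbK.
have z0 : z != 0 by apply: contraNneq y0 => z0; rewrite yE z0 mulr0.
have [zfin|zinf] := pselect (finite_quotient (multiples z)).
  apply: yinf; rewrite yE; apply: finite_quotientM => //.
  by apply: (finite_quotient_sub (I := fun w => w \isn't a GRing.unit)) Afin => w /pP.
have [||r zE] := ymax _ _ _ _ (multiples_self z); first by exists z.
  by move=> w [r ->]; exists (p * r); rewrite yE mulrCA mulrA.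
case/negP: p_nunit; apply/unitrPr; exists r; apply: (mulfI z0).
by rewrite mulr1 {2}zE yE; ring.
Qed.

(** * Consequences of dp-minimality *)

Definition exact_multiple_formula (R : unitRingType) : GRing.formula R :=
  GRing.And
    (GRing.Exists 3 (GRing.Equal (GRing.Var R 0) (GRing.Mul (GRing.Var R 1) (GRing.Var R 3))))
    (GRing.Not
      (GRing.Exists 3
        (GRing.Equal (GRing.Var R 0) (GRing.Mul (GRing.Var R 2) (GRing.Var R 3))))).

Definition coset_formula (R : unitRingType) : GRing.formula R :=
  GRing.Exists 3 (GRing.Equal (GRing.Var R 0)
    (GRing.Add (GRing.Var R 1) (GRing.Mul (GRing.Var R 2) (GRing.Var R 3)))).

(** The translate by 'X_1 of the set of p-th powers modulo 'X_2. With modulus pi^2 it reads off the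
    coordinate y of x^p + pi y. *)
Definition power_coset_formula (R : unitRingType) p : GRing.formula R :=
  GRing.Exists 3 (GRing.Exists 4 (GRing.Equal (GRing.Var R 0)
    (GRing.Add (GRing.Exp (GRing.Var R 3) p)
      (GRing.Add (GRing.Var R 1) (GRing.Mul (GRing.Var R 2) (GRing.Var R 4)))))).

Lemma ideal_unit (R : comUnitRingType) (I : R -> Prop) u :
  is_ideal I -> u \is a GRing.unit -> I u -> forall x, I x.
Proof. by move=> Iid uU Iu x; rewrite -[x](divrK uU); apply: ideal_mull. Qed.

Lemma multiples_proper (R : comUnitRingType) (a : R) :
  a \isn't a GRing.unit -> ~ multiples a 1.
Proof. by move=> aN [r a1]; case/negP: aN; apply/unitrPr; exists r. Qed.

(* If a + b = 1 with nonunits a and b, then a^i b^j lies in a^k R \ a^(k+1) R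
   exactly for k = i, and symmetrically for b. *)
Lemma dp_minimal_local (R : idomainType) : dp_minimal R -> local_ring R.
Proof.
move=> [_ Rmin].
have comax (a b : R) : a + b = 1 -> a \isn't a GRing.unit -> b \isn't a GRing.unit -> False.
  move=> ab1 aN bN; have [N] := Rmin (exact_multiple_formula R) (exact_multiple_formula R).
  apply; exists (fun i => [:: a ^+ i; a ^+ i.+1]), (fun j => [:: b ^+ j; b ^+ j.+1]).
  have exact_power (c d : R) i j k : c + d = 1 -> c \isn't a GRing.unit ->
      d \isn't a GRing.unit ->
      GRing.holds [:: c ^+ i * d ^+ j; c ^+ k; c ^+ k.+1] (exact_multiple_formula R) <-> k = i.
    move=> cd1 cN dN.
    have c0 : c != 0.
      by apply: contraNneq dN => c0; move: cd1; rewrite c0 add0r => ->; apply: unitr1.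
    (* As d = 1 modulo c, if c divided d^(j+1) it would divide d^j, and in the end 1. *)
    have dNc : ~ multiples c (d ^+ j).
      elim: j => [|j IHj]; first exact: multiples_proper.
      case=> r dE; apply: IHj; exists (r + d ^+ j).
      by rewrite mulrDr -dE exprS -mulrDl addrC cd1 mul1r.
    split=> /= [[[y yE] nE]|->]; last first.
      split=> [|[y]]; first by exists (d ^+ j).
      by rewrite exprSr -mulrA => /(mulfI (expf_neq0 i c0)) dE; apply: dNc; exists y.
    case: (ltngtP k i) => // [ltki|ltik].
      case: nE; exists (c ^+ (i - k.+1) * d ^+ j).
      by rewrite mulrA -exprD subnKC.
    case: dNc; exists (c ^+ (k - i.+1) * y); apply: (mulfI (expf_neq0 i c0)).
    by rewrite yE !mulrA -exprSr -exprD subnKC.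
  move=> i j _ _; exists (a ^+ i * b ^+ j) => i' j' _ _.
  by split; [|rewrite mulrC]; apply: exact_power; rewrite // addrC.
split; first by rewrite unitr0.
split=> [x y xN yN|r x]; last by rewrite unitrM negb_and => ->; rewrite orbT.
apply/negP => xyU; apply: (comax (x / (x + y)) (y / (x + y))).
- by rewrite -mulrDl divrr.
- by rewrite unitrM negb_and xN.
- by rewrite unitrM negb_and yN.
Qed.

Section Index.
Variable R : idomainType.

Definition separated_family N (I : R -> Prop) (r : nat -> R) :=
  forall i j, (i < N)%N -> (j < N)%N -> i != j -> ~ I (r i - r j).

(** For an ideal I this says that R/I has fewer than N elements. *)
Definition index_below N (I : R -> Prop) := ~ exists r, separated_family N I r.

(** The ideal quotient (aR : b); for b nonzero its index is that of the intersection of aR and bR in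
    bR. *)
Definition conductor (a b : R) : R -> Prop := fun x => multiples a (b * x).

Lemma conductor_ideal a b : is_ideal (conductor a b).
Proof.
rewrite /conductor; split; first by rewrite mulr0; apply: (ideal_zero (multiples_ideal a)).
split=> [x y xP yP|r x xP]; first by rewrite mulrDr; apply: (ideal_add (multiples_ideal a)).
by rewrite mulrCA; apply: (ideal_mull _ (multiples_ideal a)).
Qed.

(** If the b r_i are distinct modulo aR and the a s_j distinct modulo bR, then b r_i + a s_j lies in
    b r_k + aR only for k = i and in a s_l + bR only for l = j: a pattern of depth 2. *)
Lemma dp_minimal_index : dp_minimal R -> exists N, forall a b,
  index_below N (conductor a b) \/ index_below N (conductor b a).
Proof.
move=> [_ Rmin]; have [N noN] := Rmin (coset_formula R) (coset_formula R).
exists N => a b; apply: contrapT => /not_orP[/contrapT[r rP] /contrapT[s sP]].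
apply: noN; exists (fun i => [:: b * r i; a]), (fun j => [:: a * s j; b]).
move=> i j ltiN ltjN; exists (b * r i + a * s j) => i' j' lti'N ltj'N /=.
split; split=> [[y yE]|->].
- case: (eqVneq i' i) => // /(rP _ _ lti'N ltiN); case.
  exists (s j - y); apply/eqP; rewrite -subr_eq0; apply/eqP.
  by move/eqP: yE; rewrite -subr_eq0 => /eqP yE; rewrite -[RHS]oppr0 -yE; ring.
- by exists (s j).
- case: (eqVneq j' j) => // /(sP _ _ ltj'N ltjN); case.
  exists (r i - y); apply/eqP; rewrite -subr_eq0; apply/eqP.
  by move/eqP: yE; rewrite -subr_eq0 => /eqP yE; rewrite -[RHS]oppr0 -yE; ring.
- by exists (r i); rewrite addrC.
Qed.

End Index.

(** The error term keeps its factor y: for y = pi u and pi dividing p, it is then divisible by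
    pi^2. *)
Lemma exprD_prime (R : comNzRingType) p (x y : R) : prime p ->
  exists v, (x + y) ^+ p = x ^+ p + y ^+ p + p%:R * y * v.
Proof.
move=> p_prime; have p_gt0 := prime_gt0 p_prime.
rewrite exprDn -(prednK p_gt0) big_ord_recl big_ord_recr /= prednK //.
have -> : bump 0 p.-1 = p by rewrite /bump add1n prednK.
rewrite bin0 binn subn0 subnn !mulr1n mulr1 mul1r.
set S := (\sum_(i < p.-1) _); suff [v ->] : multiples (p%:R * y) S.
  by exists v; rewrite addrA addrAC.
apply: big_ind => [|u w [u' ->] [w' ->]|i _].
- by exists 0; rewrite mulr0.
- by exists (u' + w'); rewrite mulrDr.
have /dvdnP[k ->] : (p %| 'C(p, bump 0 i))%N.
  by apply: prime_dvd_bin => //; rewrite /bump add1n; have := ltn_ord i; rewrite -ltnS prednK.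
exists (x ^+ (p - bump 0 i) * y ^+ i * k%:R).
by rewrite -mulr_natl natrM /bump /= add1n exprS; ring.
Qed.

Lemma residue_char_prime (R : comUnitRingType) : ~ residue_char0 R ->
  exists2 p, prime p & (p%:R : R) \isn't a GRing.unit.
Proof.
move=> /existsNP[n /not_implyP[n_gt0 /negP nN]]; apply: contrapT => nop.
elim/ltn_ind: n => n IHn in n_gt0 nN *.
have [n1|n_gt1] := leqP n 1; first by move: nN; rewrite (@anti_leq n 1) ?n1 ?n_gt0 // unitr1.
have pn := pdiv_dvd n; have pP := pdiv_prime n_gt1.
have [pN|pU] := boolP ((pdiv n)%:R \is a @GRing.unit R); last by apply: nop; exists (pdiv n).
apply: (IHn (n %/ pdiv n)%N).
- by apply: ltn_Pdiv => //; apply: prime_gt1.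
- by rewrite divn_gt0 ?prime_gt0 // dvdn_leq.
by move: nN; rewrite -{1}(divnK pn) natrM unitrM pN andbT.
Qed.

(* If the residue characteristic is p, then x^p mod pi^2 only depends on x mod pi,
   so that (x, y) |-> x^p + pi y mod pi^2 embeds the square of the residue field
   definably into R / pi^2. *)
Lemma dp_minimal_residue (A : idomainType) :
  DVR A -> dp_minimal A -> residue_finite A \/ residue_char0 A.
Proof.
move=> Advr [_ Amin]; have [|Ainf] := pselect (residue_finite A); first by left.
right; apply: contrapT => /residue_char_prime[p p_prime pN].
have [pi pi0 piP] := DVR_uniformizer Advr.
have [_ [Aloc _]] := Advr; have [r rP] := infinite_quotient_sequence Aloc Ainf.
have [q pE] : multiples pi p%:R by apply/piP.
(* Frobenius is additive modulo p, hence modulo pi, so it is injective on the residue field. *)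
have powN (x y : A) : multiples pi (x ^+ p - y ^+ p) -> multiples pi (x - y).
  move=> xy; apply/piP; apply/negP => xyU.
  have [v vE] := exprD_prime (x - y) y p_prime.
  have : (x - y) ^+ p \isn't a GRing.unit; last by rewrite unitrX.
  apply/piP; have -> : (x - y) ^+ p = x ^+ p - y ^+ p - pi * (q * y * v).
    by rewrite subrK in vE; rewrite vE pE; ring.
  apply: ideal_sub => //; first exact: multiples_ideal.
  by exists (q * y * v).
have pow2 (x y : A) : multiples pi (x - y) -> multiples (pi ^+ 2) (x ^+ p - y ^+ p).
  case=> u uE; have [v vE] := exprD_prime y (pi * u) p_prime.
  exists (pi ^+ (p - 2) * u ^+ p + q * u * v).
  have -> : x = y + pi * u by rewrite -uE addrC subrK.
  have pi_p : pi ^+ p = pi ^+ 2 * pi ^+ (p - 2) by rewrite -exprD subnKC ?prime_gt1.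
  by rewrite vE exprMn pE pi_p; ring.
have [N] := Amin (coset_formula A) (power_coset_formula A p); apply.
exists (fun i => [:: r i ^+ p; pi]), (fun j => [:: pi * r j; pi ^+ 2]).
move=> i j _ _; exists (r i ^+ p + pi * r j) => i' j' _ _ /=.
split; split=> [|->]; last 1 first.
- by exists (r i), 0; rewrite mulr0 addr0.
- case=> y yE; case: (eqVneq i' i) => // /rP; case; apply/piP; apply: powN.
  exists (r j - y); rewrite mulrBr.
  have -> : r i' ^+ p = r i ^+ p + pi * r j - pi * y by rewrite yE addrK.
  ring.
- by exists (r j).
case=> w [z yE]; case: (eqVneq j' j) => // /rP; case; apply/piP.
(* Reduction modulo pi identifies w with r_i; then w^p and r_i^p agree modulo pi^2, which leaves pi
   r_j = pi r_j' modulo pi^2. *)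
have rw : multiples pi (r i - w).
  apply: powN; exists (r j' + pi * z - r j).
  have -> : r i ^+ p = w ^+ p + (pi * r j' + pi ^+ 2 * z) - pi * r j by rewrite -yE addrK.
  ring.
have [u uE] := pow2 _ _ rw; exists (u - z); apply: (mulfI pi0).
have /eqP := yE; rewrite -subr_eq0 => /eqP E0.
have riE : r i ^+ p = pi ^+ 2 * u + w ^+ p by rewrite -uE subrK.
by apply/eqP; rewrite -subr_eq0; apply/eqP; rewrite -[RHS]oppr0 -E0 riE; ring.
Qed.

(** * Finite-index subrings *)

Lemma infinite_type_inj (T U : eqType) (f : T -> U) :
  injective f -> infinite_type T -> infinite_type U.
Proof.
move=> f_inj Tinf [s sP].
have [|x [x' [y [+ + xy]]]] := @infinite_type_pigeonhole T U (fun x y => f x = y) s Tinf.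
  by move=> x; exists (f x).
by rewrite -xy => /eqP nxx' /f_inj.
Qed.

Section FiniteIndexSubring.
Variables (R A : idomainType) (f : {rmorphism R -> A}).
Hypotheses (f_inj : injective f) (Advr : DVR A) (Amin : dp_minimal A).
Hypotheses (Afin : residue_finite A).
Variable t : seq A.
Hypothesis tP : forall a, exists2 y, y \in t & exists x, a - y = f x.

Lemma finite_index_subring_infinite : infinite_type R.
Proof.
move=> [s sP]; apply: Amin.1; exists [seq y + f x | y <- t, x <- s] => a.
have [y yt [x xE]] := tP a; apply/allpairsP; exists (y, x); split=> //=.
by rewrite -xE addrC subrK.
Qed.

(** For each coset representative y, infinitely many x and finitely many cosets give x != x' with y
    f(x) and y f(x') in the same coset, so f(x - x') y lies in f(R). The product of these
    differences works for all y. *)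
Lemma finite_index_conductor :
  exists2 g : R, g != 0 & forall a, exists r, f g * a = f r.
Proof.
have [g g0 gP] : exists2 g : R, g != 0 & forall y, y \in t -> exists r, f g * y = f r.
  elim: (t) => [|y u [g g0 gP]]; first by exists 1; rewrite ?oner_neq0.
  have [|x [x' [c [xx' [z zE] [z' z'E]]]]] := @infinite_type_pigeonhole R A
      (fun x c => exists z, y * f x - c = f z) t finite_index_subring_infinite.
    by move=> x; apply: tP.
  exists (g * (x - x')) => [|y']; first by rewrite mulf_neq0 // subr_eq0.
  rewrite inE => /orP[/eqP->|/gP[r rE]].
    exists (g * (z - z')); rewrite !rmorphM !rmorphB -zE -z'E; ring.
  by exists ((x - x') * r); rewrite !rmorphM -rE; ring.
exists g => // a; have [y /gP[r rE] [x xE]] := tP a.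
by exists (r + g * x); rewrite rmorphD rmorphM -rE -xE; ring.
Qed.

Lemma finite_index_subring_dp_minimal : dp_minimal R.
Proof.
have [g g0 gP] := finite_index_conductor.
have fg0 : f g != 0 by rewrite -(rmorph0 f) (inj_eq f_inj).
have [||||u uP] := @union_of_cosets A (fun y => exists x, y = f x) (f g).
- by move=> _ _ [x ->] [y ->]; exists (x + y); rewrite rmorphD.
- by move=> _ [x ->]; exists (- x); rewrite rmorphN.
- exact: gP.
- exact: DVR_finite_quotient.
apply: (dp_minimal_transfer f_inj _ uP) => //; last exact: finite_index_subring_infinite.
by move=> x y; rewrite /= rmorph1 mul1r rmorphM.
Qed.

(* A nonzero ideal of R contains x g A, for some x != 0 and g in the conductor,
   hence has finite index in A. *)
Lemma finite_index_subring_noetherian : noetherian R.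
Proof.
move=> I Iid Isub; have [g g0 gP] := finite_index_conductor.
have leI m n x : (m <= n)%N -> I m x -> I n x.
  by move=> /subnK<-; elim: (n - m)%N => // k IHk /IHk/Isub.
have [[m [x [Ix x0]]]|I0] := pselect (exists m x, I m x /\ x != 0); last first.
  exists 0%N => n x _ Inx; have [->|x0] := eqVneq x 0; first exact: ideal_zero.
  by case: I0; exists n, x.
have fxg0 : f (x * g) != 0 by rewrite -(rmorph0 f) (inj_eq f_inj) mulf_neq0.
have [s sP] := DVR_finite_quotient Advr Afin fxg0.
(* There are finitely many representatives, so from some stage M on, those that ever enter the chain
   have entered it. *)
have [M MP] : exists M, forall y, y \in s -> forall n z, I n z -> y = f z ->
    exists2 z', I M z' & y = f z'.
  elim: (s) => [|y u [M MP]]; first by exists 0%N.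
  have [[k [w [Ikw yE]]]|noz] := pselect (exists n z, I n z /\ y = f z); last first.
    exists M => y'; rewrite inE => /orP[/eqP->|/MP//] n z Inz yE.
    by case: noz; exists n, z.
  exists (maxn k M) => y'; rewrite inE => /orP[/eqP-> _ _ _ _|/MP{}MP n z Inz zE].
    by exists w => //; apply: leI Ikw; apply: leq_maxl.
  by have [z' IMz' ?] := MP n z Inz zE; exists z' => //; apply: leI IMz'; apply: leq_maxr.
exists (maxn m M) => n z le_n Inz; have [y ys [a aE]] := sP (f z).
have [r rE] := gP a; have yE : y = f (z - x * r).
  by rewrite rmorphB !rmorphM -rE mulrA -rmorphM -aE opprB addrC subrK.
have Ixr k : (m <= k)%N -> I k (x * r) by move=> lemk; apply: ideal_mulr => //; apply: leI Ix.
have [|z' IMz' z'E] := MP y ys n (z - x * r) _ yE.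
  by apply: ideal_sub => //; apply: Ixr; apply: leq_trans le_n; apply: leq_maxl.
have -> : z = z' + x * r by apply: f_inj; rewrite rmorphD -z'E yE -rmorphD subrK.
apply: ideal_add => //; last by apply: Ixr; apply: leq_maxl.
by apply: leI IMz'; apply: leq_maxr.
Qed.

End FiniteIndexSubring.

(** * Dp-minimal Noetherian domains *)

Lemma fraction_ratio (R : idomainType) (x : {fraction R}) :
  exists a b : R, b != 0 /\ x = a%:F / b%:F.
Proof.
suff [a [b [b0 xE]]] : exists a b : R, b != 0 /\ x * b%:F = a%:F.
  by exists a, b; split=> //; rewrite -xE mulfK // tofrac_eq0.
elim/quotW: x => r; exists r.1, r.2; split; first exact: denom_ratioP.
unlock FracField.tofrac; rewrite -[LHS]FracField.pi_mul; apply/eqmodP => /=.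
rewrite FracField.equivfE /FracField.mulf.
by rewrite !numden_Ratio ?mulf_neq0 ?oner_neq0 ?denom_ratioP // !mulr1 mulrC.
Qed.

Section Total.
Variable A : idomainType.
Hypothesis total : forall a b : A, multiples a b \/ multiples b a.

Lemma total_divisibility_local : local_ring A.
Proof.
split; first by rewrite unitr0.
split=> [x y xN yN|r x]; last by rewrite unitrM negb_and => ->; rewrite orbT.
have [[r ->]|[r ->]] := total x y.
  by rewrite -{1}[x]mulr1 -mulrDr unitrM negb_and xN.
by rewrite -{2}[y]mulr1 -mulrDr unitrM negb_and yN.
Qed.

Lemma total_divisibility_principal : noetherian A -> principal_ideal_ring A.
Proof.
move=> Anoeth I Iid.
pose F J := exists2 x : A, I x & J = multiples x.
have [||_ [x Ix ->] xmax] := noetherian_maximal (F := F) (I0 := multiples 0) Anoeth.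
- by move=> _ [x _ ->]; apply: multiples_ideal.
- by exists 0 => //; apply: ideal_zero.
exists x => y; split=> [Iy|[r ->]]; last exact: ideal_mull.
suff [r ->] : multiples x y by exists r; rewrite mulrC.
have [//|xy] := total x y.
apply: (xmax (multiples y)); [by exists y| |exact: multiples_self].
exact: multiples_min (multiples_ideal y) xy.
Qed.

End Total.

(** The quotients q_n = d / x^n generate an ascending chain of ideals. Where it stops, q_(n+1) is a
    multiple of q_n = x q_(n+1), so it vanishes, x being a nonunit. *)
Lemma noetherian_powers (R : idomainType) (x d : R) : noetherian R ->
  x \isn't a GRing.unit -> (forall n, multiples (x ^+ n) d) -> d = 0.
Proof.
move=> Rnoeth xN /choice[q qP].
have [x0|x0] := eqVneq x 0; first by rewrite (qP 1%N) expr1 x0 mul0r.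
have qS n : q n = x * q n.+1.
  by apply: (mulfI (expf_neq0 n x0)); rewrite -qP mulrA -exprSr.
have [||n0 /(_ n0.+1 (q n0.+1))n0P] := Rnoeth (fun n => multiples (q n)).
- by move=> n; apply: multiples_ideal.
- by move=> n _ [r ->]; exists (x * r); rewrite qS mulrCA mulrA.
have [r qE] := n0P (leqnSn _) (multiples_self _).
rewrite (qP n0.+1); have [->|q0] := eqVneq (q n0.+1) 0; first by rewrite mulr0.
case/negP: xN; apply/unitrPr; exists r; apply: (mulfI q0).
by rewrite mulr1 {2}qE (qS n0); ring.
Qed.

(** By R-linearity, h maps ideals of A to ideals of R. *)
Lemma noetherian_embedding (R A : idomainType) (f : R -> A) (h : A -> R) :
  injective h -> {morph h : x y / x + y} -> h 0 = 0 ->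
  (forall r x, h (f r * x) = r * h x) -> noetherian R -> noetherian A.
Proof.
move=> h_inj hD h0 hf Rnoeth I Iid Isub.
have [||n0 n0P] := Rnoeth (fun n y => exists2 x, I n x & y = h x).
- move=> n; split; first by exists 0 => //; apply: ideal_zero.
  split=> [_ _ [x Ix ->] [y Iy ->]|r _ [x Ix ->]].
    by exists (x + y) => //; apply: ideal_add.
  by exists (f r * x) => //; apply: ideal_mull.
- by move=> n _ [x Ix ->]; exists x => //; apply: Isub.
exists n0 => n x le_n Inx; have [|x' Ix' /h_inj->//] := n0P n (h x) le_n.
by exists x.
Qed.

(** * Divisibility up to powers of the maximal ideal *)

Section LocalNoetherian.
Variable R : idomainType.
Hypotheses (Rloc : local_ring R) (Rnoeth : noetherian R).

Definition nonunits (s : seq R) := all (fun x => x \isn't a GRing.unit) s.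

(** Among the N proper initial products two are congruent modulo I, say r_i and r_j = r_i m. As m is
    a nonunit, 1 - m is a unit, so r_i is in I. *)
Lemma index_below_prod N (I : R -> Prop) (s : seq R) : is_ideal I -> index_below N I ->
  size s = N -> nonunits s -> I (\prod_(x <- s) x).
Proof.
move=> Iid IN sN sU; pose r i := \prod_(x <- take i s) x.
suff [i [j [ltij ltjN Iij]]] : exists i j, [/\ (i < j)%N, (j < N)%N & I (r i - r j)].
  pose m := \prod_(x <- drop i (take j s)) x.
  have rjE : r j = r i * m.
    by rewrite /r /m -(take_takel s (ltnW ltij)) -big_cat cat_take_drop.
  have mN : m \isn't a GRing.unit.
    have : nonunits (drop i (take j s)).
      by apply/allP => x /mem_drop/mem_take; apply/allP: x.
    have : size (drop i (take j s)) != 0%N.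
      by rewrite size_drop size_take sN ltjN subn_eq0 -ltnNge.
    rewrite /m; case: (drop i (take j s)) => //= x u _ /andP[xN _].
    by rewrite big_cons unitrM negb_and xN.
  have mU : 1 - m \is a GRing.unit.
    apply: contraT => nU; have := ideal_add Rloc nU mN.
    by rewrite subrK unitr1.
  have Ir : I (r i).
    by rewrite -[r i](mulrK mU); apply: ideal_mulr => //; rewrite mulrBr mulr1 -rjE.
  rewrite -[s](cat_take_drop i) big_cat; exact: ideal_mulr.
apply: contrapT => noij; apply: IN; exists r => i j ltiN ltjN; case: ltngtP => // ltij _ Iij.
  by apply: noij; exists i, j.
by apply: noij; exists j, i; split=> //; rewrite -opprB; apply: ideal_opp.
Qed.

(** The ideal quotient (fR : m^k), m being the ideal of nonunits; products of k nonunits generate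
    m^k. *)
Definition nonunits_into (f : R) k : R -> Prop :=
  fun x => forall s, size s = k -> nonunits s -> multiples f (x * \prod_(y <- s) y).

Lemma nonunits_into_ideal f k : is_ideal (nonunits_into f k).
Proof.
split=> [s _ _|]; first by rewrite mul0r; apply: ideal_zero (multiples_ideal f).
split=> [x y xP yP s sk sN|r x xP s sk sN].
  by rewrite mulrDl; apply: (ideal_add (multiples_ideal f)); [apply: xP|apply: yP].
by rewrite -mulrA; apply: (ideal_mull _ (multiples_ideal f)); apply: xP.
Qed.

Lemma nonunits_into_comp f g k l x y : nonunits_into f k x ->
  nonunits_into g l y -> multiples y f -> nonunits_into g (k + l) x.
Proof.
move=> xP yP [u fE] s skl; rewrite -{1 2}(cat_take_drop k s) /nonunits all_cat => /andP[s1 s2].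
have [|v vE] := xP (take k s) _ s1; first by rewrite size_takel // skl leq_addr.
have [|w wE] := yP (drop k s) _ s2; first by rewrite size_drop skl addKn.
exists (w * u * v); rewrite big_cat /= mulrA vE fE !mulrA -wE; ring.
Qed.

Lemma nonunits_intoS f k x : nonunits_into f k x -> nonunits_into f k.+1 x.
Proof.
move=> xP [|y s] // [sk] /andP[_ sN]; rewrite big_cons mulrCA.
by apply: (ideal_mull _ (multiples_ideal f)); apply: xP.
Qed.

Lemma nonunits_into_leq f k l x :
  (k <= l)%N -> nonunits_into f k x -> nonunits_into f l x.
Proof.
by move=> /subnK<-; elim: (l - k)%N => // m IHm /IHm; apply: nonunits_intoS.
Qed.

(* Divisibility up to a power of the maximal ideal is total, so a nonunit f which
   is maximal for it divides all nonunits in that sense. *)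
Lemma nonunits_into_nonunit N :
  (forall a b : R, index_below N (conductor a b) \/ index_below N (conductor b a)) ->
  exists2 f : R, f \isn't a GRing.unit & exists k, nonunits_into f k 1.
Proof.
move=> RN; pose J f x := exists k, nonunits_into f k x.
have J_ideal f : is_ideal (J f).
  split; first by exists 0%N; exact: (ideal_zero (nonunits_into_ideal f 0)).
  split=> [x y [k xP] [l yP]|r x [k xP]].
    exists (maxn k l); apply: (ideal_add (nonunits_into_ideal f (maxn k l))).
      by apply: nonunits_into_leq xP; apply: leq_maxl.
    by apply: nonunits_into_leq yP; apply: leq_maxr.
  by exists k; apply: (ideal_mull r (nonunits_into_ideal f k)) xP.
have Jself f : J f f.
  by exists 0%N => s _ _; exists (\prod_(y <- s) y).
pose F I := exists2 f : R, f \isn't a GRing.unit & I = J f.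
have [||_ [f fN ->] fmax] := noetherian_maximal (F := F) (I0 := J 0) Rnoeth.
- by move=> _ [f _ ->].
- by exists 0 => //; rewrite unitr0.
exists f => //.
have conductor_into a b : index_below N (conductor a b) -> nonunits_into a N b.
  by move=> abN s sN sU; exact: (index_below_prod (conductor_ideal a b) abN sN sU).
have Jall x : x \isn't a GRing.unit -> J f x.
  move=> xN; have [/conductor_into fx|/conductor_into xf] := RN f x; first by exists N.
  apply: (fmax (J x)) => //; first by exists x.
  move=> y [k yP]; exists (k + N)%N.
  exact: nonunits_into_comp yP xf (multiples_self f).
(* In [Jall] the exponent depends on x. Stabilization of the chain of the (fR : m^n) gives a uniform
   k, and x itself is one further factor. *)
have [||k kP] := @Rnoeth (nonunits_into f).
- exact: nonunits_into_ideal.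
- by move=> n x; apply: nonunits_intoS.
exists k.+1 => -[|x s] // [sk] /andP[xN sN]; rewrite big_cons mul1r.
have [l xl] := Jall x xN.
by apply: (kP (maxn k l) x (leq_maxl k l) (nonunits_into_leq (leq_maxr k l) xl)).
Qed.

(** Let I be maximal among the ideals of infinite index containing f. As m^k lies in I, some y
    outside I has m y inside I. Then I + Ry has finite index by maximality, and (I + Ry)/I is a
    quotient of the finite residue field. *)
Lemma nonunits_into_finite_quotient f k :
  residue_finite R -> nonunits_into f k 1 -> finite_quotient (multiples f).
Proof.
move=> [t tP] fk; apply: contrapT => finf.
pose F (I : R -> Prop) :=
  [/\ is_ideal I, forall x, multiples f x -> I x & ~ finite_quotient I].
have [||I [Iid fI Iinf] Imax] := noetherian_maximal (F := F) (I0 := multiples f) Rnoeth.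
- by move=> I [].
- by split=> //; apply: multiples_ideal.
have nI1 : ~ I 1.
  move=> I1; apply: Iinf; exists [:: 0] => x; exists 0; rewrite ?mem_head // subr0.
  by rewrite -[x]mulr1; apply: ideal_mull.
have [y nIy yI] : exists2 y, ~ I y & forall x, x \isn't a GRing.unit -> I (x * y).
  suff socle l y : ~ I y ->
      (forall s, size s = l -> nonunits s -> I (y * \prod_(z <- s) z)) ->
      exists2 y, ~ I y & forall x, x \isn't a GRing.unit -> I (x * y).
    by apply: (socle k 1 nI1) => s sk sN; apply: fI; apply: fk.
  elim: l y => [|l IHl] y nIy ys.
    by case: nIy; have := ys [::] erefl isT; rewrite big_nil mulr1.
  have [yI|/existsNP[x /not_implyP[xN nIxy]]] :=
    pselect (forall x, x \isn't a GRing.unit -> I (x * y)); first by exists y.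
  apply: (IHl (x * y)) => // s sk sN; rewrite [x * y]mulrC -mulrA.
  have := ys (x :: s); rewrite big_cons; apply; first by rewrite /= sk.
  by rewrite /nonunits /= xN.
pose I' x := exists i r, I i /\ x = i + r * y.
have I'id : is_ideal I'.
  split; first by exists 0, 0; rewrite mul0r addr0; split=> //; apply: ideal_zero.
  split=> [_ _ [i [r [Ii ->]]] [j [s [Ij ->]]]|s _ [i [r [Ii ->]]]].
    by exists (i + j), (r + s); split; [apply: ideal_add|ring].
  by exists (s * i), (s * r); split; [apply: ideal_mull|ring].
have II' x : I x -> I' x by move=> Ix; exists x, 0; rewrite mul0r addr0.
have [[s sP]|I'inf] := pselect (finite_quotient I'); last first.
  apply: nIy; apply: (Imax I') => //; first by split=> // x /fI/II'.
  by exists 0, 1; rewrite mul1r add0r; split=> //; apply: ideal_zero.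
apply: Iinf; exists [seq c + d * y | c <- s, d <- t] => x.
have [c cs [i [r [Ii xE]]]] := sP x; have [d dt rN] := tP r.
exists (c + d * y); first by apply/allpairsP; exists (c, d).
have -> : x - (c + d * y) = i + (r - d) * y by rewrite opprD addrA xE; ring.
by apply: ideal_add => //; apply: yI.
Qed.

End LocalNoetherian.

(** For x = a/b the denominator b^n clears every x^m, since x^m is a power of x^n times x^(m mod
    n). *)
Lemma almost_integral_root (R : idomainType) (x : {fraction R}) n :
  (0 < n)%N -> tofrac_image (x ^+ n) -> x \in @almost_integral R.
Proof.
move=> n_gt0 [s sE]; have [a [b [b0 xE]]] := fraction_ratio x.
have bF0 : b%:F != 0 by rewrite tofrac_eq0.
apply/almost_integralP; exists (b ^+ n) => [|m]; first exact: expf_neq0.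
have le_mod : (m %% n <= n)%N by apply/ltnW/ltn_pmod.
exists (s ^+ (m %/ n) * (b ^+ (n - m %% n) * a ^+ (m %% n))).
rewrite {1}(divn_eq m n) exprD mulnC exprM sE -{1}(subnK le_mod) !rmorphM !rmorphXn /=.
rewrite exprD xE expr_div_n mulrCA -mulrA [b%:F ^+ (m %% n) * _]mulrCA.
by rewrite (mulfV (expf_neq0 _ bF0)) mulr1.
Qed.

Lemma to_cic_nonunit (R : idomainType) (x : R) : noetherian R ->
  x \isn't a GRing.unit -> to_cic x \isn't a GRing.unit.
Proof.
move=> Rnoeth xN; rewrite cic_unitE; apply/negP => /andP[x0 /almost_integralP[d d0 dP]].
case/eqP: d0; apply: (noetherian_powers Rnoeth xN) => n; have [r rE] := dP n.
exists r; apply/eqP; rewrite -tofrac_eq rmorphM rmorphXn /= -rE /= exprVn mulrCA.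
by rewrite (mulfV (expf_neq0 _ x0)) mulr1.
Qed.

(** * The complete integral closure as a valuation ring *)

Section ValuationOverring.
Variables (R : idomainType) (e : R).
Hypotheses (Rnoeth : noetherian R) (e0 : e != 0) (eN : e \isn't a GRing.unit).
Hypothesis eP : forall a b, multiples a (b * e) \/ multiples b (a * e).

Lemma fraction_dichotomy (x : {fraction R}) :
  tofrac_image (e%:F * x) \/ x != 0 /\ tofrac_image (e%:F / x).
Proof.
have [a [b [b0 ->]]] := fraction_ratio x.
have [->|a0] := eqVneq a 0; first by left; exists 0; rewrite rmorph0 mul0r mulr0.
have aF0 : a%:F != 0 by rewrite tofrac_eq0.
have bF0 : b%:F != 0 by rewrite tofrac_eq0.
have [[r rE]|[r rE]] := eP a b.
  right; split; first exact: mulf_neq0 aF0 (invr_neq0 bF0).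
  exists r; rewrite invf_div mulrA; apply: (canLR (mulfK aF0)).
  by rewrite -!rmorphM mulrC rE mulrC.
left; exists r; rewrite mulrA; apply: (canLR (mulfK bF0)).
by rewrite -!rmorphM mulrC rE mulrC.
Qed.

(** If x is not almost integral, e^3 x^n is outside R for some n. The dichotomy for e^2 x^n then
    puts 1/(e x^n) in R, so x^-1 has its n-th power in R. *)
Lemma almost_integral_or_inv (x : {fraction R}) : x != 0 ->
  x \in @almost_integral R \/ x^-1 \in @almost_integral R.
Proof.
move=> x0; have eF0 : e%:F != 0 by rewrite tofrac_eq0.
have [|xN] := boolP (x \in @almost_integral R); [by left|right].
have [n nN] : exists n, ~ tofrac_image ((e ^+ 3)%:F * x ^+ n).
  apply/existsNP => xP; case/negP: xN; apply/almost_integralP; exists (e ^+ 3) => //.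
  exact: expf_neq0.
have n_gt0 : (0 < n)%N.
  by rewrite lt0n; apply: contra_not_neq nN => ->; exists (e ^+ 3); rewrite expr0 mulr1.
apply: (almost_integral_root n_gt0).
have [imx|[_ [r rE]]] := fraction_dichotomy (e%:F ^+ 2 * x ^+ n).
  by case: nN; rewrite rmorphXn exprS -mulrA.
exists (e * r); rewrite rmorphM /= -rE expr2 -mulrA invfM (mulVKf eF0) invfM.
by rewrite (mulVKf eF0) exprVn.
Qed.

(** Otherwise the dichotomy for e^2 x puts r = 1/(e x) in R. Then d/e^n = r^n (d x^n) is in R for
    all n, against [noetherian_powers]. *)
Lemma almost_integral_bounded (x : {fraction R}) :
  x \in @almost_integral R -> tofrac_image ((e ^+ 3)%:F * x).
Proof.
have eF0 : e%:F != 0 by rewrite tofrac_eq0.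
move=> /almost_integralP[d d0 dP].
have [|[ex0 [r rE]]] := fraction_dichotomy (e%:F ^+ 2 * x).
  by rewrite mulrA -exprS -rmorphXn.
have x0 : x != 0 by apply: contraNneq ex0 => ->; rewrite mulr0.
case/eqP: d0; apply: (noetherian_powers Rnoeth eN) => n; have [s sE] := dP n.
exists (r ^+ n * s); apply/eqP; rewrite -tofrac_eq !rmorphM !rmorphXn /= -sE -rE.
rewrite expr2 -mulrA invfM.
rewrite (mulVKf eF0) exprVn exprMn invfM -mulrA (mulVKf (expf_neq0 n eF0)) mulrCA.
by rewrite (mulVf (expf_neq0 n x0)) mulr1.
Qed.

Lemma cic_total (x y : cic R) : multiples x y \/ multiples y x.
Proof.
have [->|x0] := eqVneq x 0; first by right; exists 0; rewrite mulr0.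
have [->|y0] := eqVneq y 0; first by left; exists 0; rewrite mulr0.
have vx0 : val x != 0 by apply: contra_neq x0 => x0; apply: val_inj; rewrite x0.
have vy0 : val y != 0 by apply: contra_neq y0 => y0; apply: val_inj; rewrite y0.
have [zA|zA] := @almost_integral_or_inv (val y / val x) (mulf_neq0 vy0 (invr_neq0 vx0)).
  by left; exists (Cic zA); apply: val_inj; rewrite rmorphM /= mulrC divfK.
by right; exists (Cic zA); apply: val_inj; rewrite rmorphM /= invf_div mulrC divfK.
Qed.

(** This multiplication by e^3 has h(1) = e^3, which is why the transfer allows h(1) != 1. *)
Lemma cic_scaling : exists h : {additive cic R -> R},
  injective h /\ forall x, (h x)%:F = (e ^+ 3)%:F * val x.
Proof.
have e30 : (e ^+ 3)%:F != 0 by rewrite tofrac_eq0 expf_neq0.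
have /choice[h hE] : forall x : cic R, exists r, (e ^+ 3)%:F * val x = r%:F.
  by move=> x; apply: almost_integral_bounded; apply: valP.
have hB : zmod_morphism h.
  by move=> x y; apply/eqP; rewrite -tofrac_eq rmorphB /= -!hE -mulrBr.
pose hadd : {additive cic R -> R} :=
  HB.pack h (GRing.isZmodMorphism.Build (cic R) R h hB).
exists hadd; split=> [x y xy|x]; last by rewrite -hE.
apply: val_inj; apply: (mulfI e30).
by rewrite !hE; congr _%:F.
Qed.

Hypotheses (efin : finite_quotient (multiples e)) (Rfin : residue_finite R).

Lemma cic_mixedchar : dp_minimal R ->
  mixedchar_dpmin_DVR (cic R) /\ finite_index_subring_via (@to_cic R).
Proof.
move=> Rmin; have [h [h_inj hE]] := cic_scaling.
have hM r x : h (to_cic r * x) = r * h x.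
  by apply/eqP; rewrite -tofrac_eq rmorphM /= !hE [X in _ == X]mulrCA.
have hc r : h (to_cic r) = e ^+ 3 * r.
  by apply/eqP; rewrite -tofrac_eq rmorphM /= hE.
have [||||u uP] := @union_of_cosets R (fun y => exists x, y = h x) (e ^+ 3).
- by move=> _ _ [x ->] [y ->]; exists (x + y); rewrite raddfD.
- by move=> _ [x ->]; exists (- x); rewrite raddfN.
- by move=> z; exists (to_cic z); rewrite hc.
- exact: finite_quotientX.
have findex : finite_index_subring_via (@to_cic R).
  split; first exact: to_cic_inj.
  (* The image of h consists of cosets c + e^3 R, and e^3 R is the image of R; so the preimages of
     the c represent [cic R] modulo R. *)
  have /choice[k kP] : forall c, exists x, c \in u -> c = h x.
    move=> c; have [cu|cu] := boolP (c \in u); last by exists 0.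
    have [|x xE] := (uP c).2; last by exists x.
    by exists c => //; exists 0; rewrite mulr0 addr0.
  exists (map k u) => x; have [c cu [z zE]] := (uP (h x)).1 (ex_intro _ x erefl).
  exists (k c); first exact: map_f.
  by exists z; apply: h_inj; rewrite raddfB hc zE {1}(kP c cu) addrC addKr.
have Atot := total_divisibility_local cic_total.
have Anoeth : noetherian (cic R).
  apply: (noetherian_embedding h_inj _ _ hM Rnoeth); last exact: raddf0.
  exact: raddfD.
split=> //; split; [|split].
- split; first exact: total_divisibility_principal cic_total Anoeth.
  split=> // Afield; have := to_cic_nonunit Rnoeth eN; rewrite Afield //.
  by rewrite -(rmorph0 (@to_cic R)) (inj_eq (@to_cic_inj R)).
- apply: (dp_minimal_transfer h_inj _ uP) => //.
    move=> x y; apply/eqP; rewrite -tofrac_eq !rmorphM /= !hE.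
    by rewrite [val 1]rmorph1 mulr1 mulrACA [X in _ == X]mulrA.
  exact: infinite_type_inj (@to_cic_inj R) Rmin.1.
have [_ [t tP]] := findex; have [s sP] := Rfin.
exists [seq y + to_cic z | y <- t, z <- s] => x.
have [y yt [r rE]] := tP x; have [z zs zN] := sP r.
exists (y + to_cic z); first by apply/allpairsP; exists (y, z).
by rewrite opprD addrA rE -rmorphB; apply: to_cic_nonunit.
Qed.

End ValuationOverring.

Lemma infinite_residue_DVR (R : idomainType) : dp_minimal R -> noetherian R ->
  ~ is_field R -> ~ residue_finite R -> DVR R.
Proof.
move=> Rmin Rnoeth nfield Rinf; have Rloc := dp_minimal_local Rmin.
have [r rP] := infinite_quotient_sequence Rloc Rinf.
have [N RN] := dp_minimal_index Rmin.
(* With an infinite residue field every proper ideal has infinite index, so (aR : b) is the whole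
   ring. *)
have divP (a b : R) : index_below N (conductor a b) -> multiples a b.
  move=> abN; rewrite -[b]mulr1; apply: contrapT => nab; apply: abN; exists r => i j _ _ /rP.
  move/negP; rewrite negbK => rU /(ideal_unit (conductor_ideal a b) rU)/(_ 1).
  exact: nab.
have tot (a b : R) : multiples a b \/ multiples b a.
  by have [/divP|/divP] := RN a b; [left|right].
by split; [exact: total_divisibility_principal|].
Qed.

Lemma finite_residue_overring (R : idomainType) : dp_minimal R -> noetherian R ->
  ~ is_field R -> residue_finite R ->
  exists (A : idomainType) (f : {rmorphism R -> A}),
    mixedchar_dpmin_DVR A /\ finite_index_subring_via f.
Proof.
move=> Rmin Rnoeth nfield Rfin; have Rloc := dp_minimal_local Rmin.
have [N RN] := dp_minimal_index Rmin.
have [f fN [k fk]] := nonunits_into_nonunit Rloc Rnoeth RN.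
(* If f = 0, all nonunits are nilpotent, hence zero, and R is a field. *)
have f0 : f != 0.
  apply/eqP => f0; apply: nfield => x x0; apply: contraT => xN.
  have [||r] := fk (nseq k x); first exact: size_nseq.
    by rewrite /nonunits all_nseq xN orbT.
  rewrite f0 mul0r mul1r big_nseq => /eqP.
  by rewrite -Monoid.iteropE -/(x ^+ k) expf_eq0 (negPf x0) andbF.
(* The exponent N + 1 is visibly positive, which keeps this power a nonunit. *)
exists (cic R), (@to_cic R); apply: (@cic_mixedchar R (f ^+ N.+1)) => //.
- exact: expf_neq0.
- by rewrite unitrX_pos.
- have conductor_pow (a b : R) : index_below N (conductor a b) -> multiples a (b * f ^+ N.+1).
    move=> abN; have := index_below_prod Rloc (s := nseq N f) (conductor_ideal a b) abN.
    rewrite size_nseq /nonunits all_nseq fN orbT big_nseq => /(_ erefl isT).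
    rewrite -Monoid.iteropE -/(f ^+ N) /conductor exprSr mulrA.
    exact: (ideal_mulr _ (multiples_ideal a)).
  by move=> a b; have [/conductor_pow|/conductor_pow] := RN a b; [left|right].
- exact: finite_quotientX (nonunits_into_finite_quotient Rnoeth Rfin fk).
Qed.

Theorem theorem8p8 (R : idomainType) :
  (dp_minimal R /\ noetherian R) <->
  [\/ is_field R /\ dp_minimal R,
      equichar_dpmin_DVR R
    | exists (A : idomainType) (f : {rmorphism R -> A}),
        mixedchar_dpmin_DVR A /\ finite_index_subring_via f].
Proof.
split=> [[Rmin Rnoeth]|].
  have [Rfield|nfield] := pselect (is_field R); first by constructor 1.
  have [Rfin|Rinf] := pselect (residue_finite R).
    by constructor 3; apply: finite_residue_overring.
  have Rdvr := infinite_residue_DVR Rmin Rnoeth nfield Rinf.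
  by constructor 2; split=> //; split=> //; have [] := dp_minimal_residue Rdvr Rmin.
case=> [[Rfield Rmin]|[[Rpid _] [Rmin _]]|[A [f [[Advr [Amin Afin]] [f_inj [t tP]]]]]].
- by split=> //; apply: field_noetherian.
- by split=> //; apply: principal_noetherian.
split; first exact: finite_index_subring_dp_minimal f_inj Advr Amin Afin t tP.
exact: finite_index_subring_noetherian f_inj Advr Amin Afin t tP.
Qed.
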